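(* Let $f=\epsilon_1x_1+\dots+\epsilon_nx_n$ with $\epsilon_i\in\{-1,1\}$, viewed over $\mathbb{Q}$. Then every tree-like $\mathrm{Res}_{sw}(\mathrm{lin}_{\mathbb{Q}})$ refutation of $\neg\mathrm{Im}(f)$ has size at least $2^{n/4}$.
   Context: $im_2(f)$ is the set of values of $f$ under 0-1 assignments. For $A$ in the ring, $\langle f\ne A\rangle$ denotes the linear clause $\bigvee_{B\in im_2(f),\,B\ne A}(f=B)$, and $\neg\mathrm{Im}(f):=\{\langle f\ne A\rangle : A\in im_2(f)\}$ (an unsatisfiable set of linear clauses). A linear clause is a disjunction of linear equations (duplicates identified); variables range over $\{0,1\}$ and $\models$ is semantic implication with respect to 0-1 assignments. The system $\mathrm{Res}_{sw}(\mathrm{lin}_{\mathbb{Q}})$ has the single axiom $0=0$ and the rules: resolution (from $C\vee f=0$ and $D\vee g=0$ derive $C\vee D\vee(\alpha f+\beta g=0)$, $\alpha,\beta\in\mathbb{Q}$) and semantic weakening (from $C$ derive any linear clause $D$ with $C\models D$). A refutation is a sequence of linear clauses ending in the empty clause, each a hypothesis, the axiom, or obtained from earlier ones by a rule; tree-like means each occurrence of a clause is used at most once as a premise. Size is total number of variable occurrences plus total bit-size of coefficients. *)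

(* Defs.v *)
From HB Require Import structures.
From mathcomp Require Import all_boot all_order all_algebra.
From mathcomp Require Import finmap.

Set Implicit Arguments.
Unset Strict Implicit.
Unset Printing Implicit Defensive.

Import GRing.Theory.

Local Open Scope fset_scope.
Local Open Scope ring_scope.

(* The pair (a, b) is the affine polynomial a_1 x_1 + ... + a_n x_n + b; as a
   linear equation it stands for a_1 x_1 + ... + a_n x_n + b = 0, so that
   f = B is represented by f - (0, B). *)
Definition linpoly (n : nat) := ('rV[rat]_n * rat^o)%type.

(* Disjunction of the equations in the set; fset0 is the empty clause. *)
Definition clause (n : nat) := {fset (linpoly n)}.

Definition assignment (n : nat) := {ffun 'I_n -> bool}.

Definition eval (n : nat) (p : linpoly n) (a : assignment n) : rat :=
  \sum_(i < n) p.1 0 i * (a i)%:R + p.2.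

Definition sat (n : nat) (a : assignment n) (C : clause n) : Prop :=
  exists2 p, p \in C & eval p a = 0.

Definition entails (n : nat) (C D : clause n) : Prop :=
  forall a : assignment n, sat a C -> sat a D.

Definition im2 (n : nat) (f : linpoly n) : {fset rat} :=
  [fset eval f a | a in assignment n].

Definition avoid (n : nat) (f : linpoly n) (A : rat) : clause n :=
  [fset f - (0, B) | B in im2 f & B != A].

Definition notIm (n : nat) (f : linpoly n) : {fset (clause n)} :=
  [fset avoid f A | A in im2 f].

(* Justification of a line; premises are given by their positions. *)
Inductive inference :=
  | ByHypothesis
  | ByAxiom
  | ByResolution of nat & nat
  | ByWeakening of nat.

Definition premises (r : inference) : seq nat :=
  match r with
  | ByHypothesis | ByAxiom => [::]
  | ByResolution i j => [:: i; j]
  | ByWeakening i => [:: i]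
  end.

(* P and Q are decomposed as C \/ f = 0 and D \/ g = 0 in all possible ways:
   f may or may not also occur in C, and likewise for g and D. *)
Definition resolvent (n : nat) (P Q E : clause n) : Prop :=
  exists (C D : clause n) (f g : linpoly n) (alpha beta : rat),
    [/\ P = f |` C, Q = g |` D &
        E = (alpha *: f + beta *: g) |` (C `|` D)].

Definition inference_ok (n : nat) (H : {fset (clause n)})
    (earlier : seq (clause n)) (E : clause n) (r : inference) : Prop :=
  match r with
  | ByHypothesis => E \in H
  | ByAxiom => E = [fset (0 : linpoly n)]
  | ByResolution i j =>
      [/\ (i < size earlier)%N, (j < size earlier)%N &
          resolvent (nth fset0 earlier i) (nth fset0 earlier j) E]
  | ByWeakening i =>
      (i < size earlier)%N /\ entails (nth fset0 earlier i) E
  end.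

Definition derivation (n : nat) := seq (clause n * inference).

Definition derivation_ok (n : nat) (H : {fset (clause n)})
    (pi : derivation n) : Prop :=
  forall k, (k < size pi)%N ->
    let line := nth (fset0, ByHypothesis) pi k in
    inference_ok H (unzip1 (take k pi)) line.1 line.2.

Definition refutation (n : nat) (H : {fset (clause n)})
    (pi : derivation n) : Prop :=
  derivation_ok H pi /\ exists s, unzip1 pi = rcons s fset0.

(* No position occurs twice among all the premises used in pi; in particular
   a line is not resolved with itself. *)
Definition tree_like (n : nat) (pi : derivation n) : Prop :=
  uniq (flatten [seq premises line.2 | line <- pi]).

(* Number of binary digits of m; 0 has one digit. *)
Definition nat_bits (m : nat) : nat := maxn 1 (up_log 2 m.+1).

(* The sign is not charged for. *)
Definition rat_bits (q : rat) : nat :=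
  (nat_bits `|numq q| + nat_bits `|denq q|)%N.

(* A variable occurs when its coefficient is nonzero; the constant term is
   always written, also when it is 0. *)
Definition linpoly_size (n : nat) (p : linpoly n) : nat :=
  (\sum_(i < n | p.1 ord0 i != 0%R) (1 + rat_bits (p.1 ord0 i))
   + rat_bits p.2)%N.

Definition clause_size (n : nat) (C : clause n) : nat :=
  (\sum_(p <- C) linpoly_size p)%N.

Definition derivation_size (n : nat) (pi : derivation n) : nat :=
  (\sum_(line <- pi) clause_size line.1)%N.

(* Main.v *)
Require Import Defs.
From mathcomp Require Import all_boot all_order all_algebra.
From mathcomp Require Import finmap reals exp.
From mathcomp Require Import zify lra.

(* A list s of m disequalities that some 0-1 point satisfies defines a nonzero
   function of degree at most m on the cube, the product of its affine forms.
   For a monomial S of maximal size in it, the coordinates outside S can be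
   prescribed freely without leaving the disequalities; so if f is constant on
   the points satisfying s, then n <= 2 m.  Playing the Prover-Delayer game down
   the tree, a clause falsified by all points satisfying s roots a subtree with
   at least 2^(n/2 - m) leaves, and for the empty clause m = 0.  This gives
   2^(n/2), which is more than needed. *)

Set Implicit Arguments.
Unset Strict Implicit.
Unset Printing Implicit Defensive.

Import Order.TTheory GRing.Theory Num.Theory.

Local Open Scope ring_scope.

(** * Multilinear polynomials on the Boolean cube *)

Section Multilinear.
Variables (I : finType) (K : fieldType).
Implicit Types (S T A B : {set I}) (F : {set I} -> K).

(** A point of the cube is encoded as the set [A] of its coordinates equal to 1, so
    [(T \subset A)%:R] is the value there of the monomial with variable set [T]. *)
Definition degree_le (d : nat) F : Prop :=
  exists2 c : {set I} -> K, (forall T, (d < #|T|)%N -> c T = 0)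
    & forall A, F A = \sum_T c T * (T \subset A)%:R.

Lemma degree_le_const (x : K) : degree_le 0 (fun=> x).
Proof.
exists (fun T => if T == set0 then x else 0) => [T|A].
  by rewrite card_gt0 => /negPf->.
rewrite (bigD1 set0) //= eqxx sub0set mulr1 big1 ?addr0 // => T /negPf->.
by rewrite mul0r.
Qed.

Lemma degree_le_add d F G :
  degree_le d F -> degree_le d G -> degree_le d (fun A => F A + G A).
Proof.
move=> [c c0 cE] [e e0 eE]; exists (fun T => c T + e T) => [T dT|A].
  by rewrite c0 ?e0 ?addr0.
by rewrite cE eE -big_split; apply: eq_bigr => T _; rewrite mulrDl.
Qed.

Lemma degree_le_scale d F x :
  degree_le d F -> degree_le d (fun A => x * F A).
Proof.
move=> [c c0 cE]; exists (fun T => x * c T) => [T dT|A].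
  by rewrite c0 ?mulr0.
by rewrite cE mulr_sumr; apply: eq_bigr => T _; rewrite mulrA.
Qed.

Lemma degree_leW d e F : (d <= e)%N -> degree_le d F -> degree_le e F.
Proof.
by move=> de [c c0 cE]; exists c => // T eT; apply: c0; apply: leq_ltn_trans eT.
Qed.

(** Since x_i^2 = x_i on the cube, the monomial [U] turns into [i |: U]; the coefficients of
    monomials that merge are added. *)
Lemma degree_le_mulX d F i :
  degree_le d F -> degree_le d.+1 (fun A => (i \in A)%:R * F A).
Proof.
move=> [c c0 cE].
exists (fun T => \sum_(U | i |: U == T) c U) => [T dT|A].
  apply: big1 => U /eqP UT; apply: c0; move: dT; rewrite -UT cardsU1; lia.
rewrite cE mulr_sumr (partition_big (fun U => i |: U) predT) //=.
apply: eq_bigr => T _; rewrite mulr_suml; apply: eq_bigr => U /eqP <-.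
rewrite subUset sub1set; case: (i \in A) => //=; first by rewrite mul1r.
by rewrite mul0r mulr0.
Qed.

Lemma degree_le_sum d (J : Type) (r : seq J) (F : J -> {set I} -> K) :
  (forall j, degree_le d (F j)) -> degree_le d (fun A => \sum_(j <- r) F j A).
Proof.
move=> dF; elim: r => [|j r [c c0 cE]].
  exists (fun=> 0) => // A; rewrite big_nil big1 // => T _; exact: mul0r.
have [e e0 eE] := degree_le_add (dF j) (ex_intro2 _ _ c c0 cE).
by exists e => // A; rewrite big_cons eE.
Qed.

Lemma sum_toggle_eq0 S i (G : {set I} -> K) : i \in S ->
  (forall U : {set I}, i \notin U -> G (i |: U) = - G U) ->
  \sum_(U : {set I} | U \subset S) G U = 0.
Proof.
move=> iS GN; rewrite (bigID (fun U : {set I} => i \in U)) /=.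
rewrite (reindex_onto (fun U => i |: U) (fun U => U :\ i)) /=; last first.
  by move=> U /andP[_ iU]; rewrite setD1K.
rewrite (eq_bigl (fun U : {set I} => (U \subset S) && (i \notin U))) => [|U].
  by rewrite -big_split big1 //= => U /andP[_ iU]; rewrite GN // addNr.
rewrite subUset sub1set iS setU11 andbT /=; congr (_ && _).
apply/eqP/idP => [<-|iU]; first by rewrite !inE eqxx.
by rewrite setU1K.
Qed.

(* The witness S is a monomial of maximal size: summing F with signs over all
   settings of the variables of S isolates its coefficient. *)
Lemma degree_le_free_coordinates d F A0 : degree_le d F -> F A0 != 0 ->
  exists2 S : {set I}, (#|S| <= d)%N
    & forall B, exists2 A, A :\: S = B :\: S & F A != 0.
Proof.
move=> [c c0 cE] FA0.
have [T0 cT0] : exists T, c T != 0.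
  apply/existsP; apply: contraNT FA0 => /existsPn ccst.
  rewrite cE big1 // => T _; move/eqP: (negPn (ccst T)) => ->; exact: mul0r.
case: (@arg_maxnP _ T0 (fun T => c T != 0) (fun T => #|T|) cT0) => S cS Smax.
exists S => [|B]; first by rewrite leqNgt; apply: contraNN cS => /c0 ->.
(* For [U] inside [S], this point follows [U] on [S] and [B] outside [S]. *)
pose point (U : {set I}) := (B :\: S) :|: U.
pose sgnsum (T : {set I}) := \sum_(U : {set I} | U \subset S) (-1) ^+ #|U| * (T \subset point U)%:R : K.
have sumE : \sum_(U : {set I} | U \subset S) (-1) ^+ #|U| * F (point U)
            = \sum_T c T * sgnsum T.
  under eq_bigr => U _ do rewrite cE mulr_sumr.
  rewrite exchange_big; apply: eq_bigr => T _; rewrite mulr_sumr.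
  by apply: eq_bigr => U _; rewrite mulrCA.
(* Only the term [U = S] survives: the monomial [S] vanishes at all other points. *)
have sgnsumS : sgnsum S = (-1) ^+ #|S|.
  rewrite /sgnsum (bigD1 S) //= subsetUr mulr1 big1 ?addr0 // => U /andP[US neUS].
  case SU: (S \subset point U); last by rewrite mulr0.
  case/eqP: neUS; apply/eqP; rewrite eqEsubset US; apply/subsetP => x xS.
  by move/subsetP: SU => /(_ x xS); rewrite !inE xS.
(* If [c T] is nonzero, maximality of [S] gives some [i] in [S] outside [T]; toggling [i] in [U]
   flips the sign and keeps the monomial. *)
have sgnsum0 T : T != S -> c T * sgnsum T = 0.
  have [->|cT] := eqVneq (c T) 0; first by rewrite mul0r.
  move=> neTS; have /subsetPn[i iS iT] : ~~ (S \subset T).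
    apply: contraNN neTS => ST; rewrite eq_sym eqEcard ST; exact: Smax.
  rewrite /sgnsum (sum_toggle_eq0 iS) ?mulr0 // => U iU.
  rewrite cardsU1 iU exprS mulN1r mulNr; congr (- (_ * (nat_of_bool _)%:R)).
  apply/idP/idP => /subsetP Tp; apply/subsetP => x xT; move: (Tp x xT); rewrite !inE.
    by case: eqP => // xi; rewrite -xi xT in iT.
  by case/orP=> ->; rewrite ?orbT.
suff /existsP[A /andP[/eqP AB FA]] : [exists A, (A :\: S == B :\: S) && (F A != 0)].
  by exists A.
apply: contraT => /existsPn FN.
have : c S * sgnsum S = 0.
  transitivity (\sum_T c T * sgnsum T).
    by rewrite [RHS](bigD1 S) //= [X in _ + X]big1 ?addr0 // => T /sgnsum0.
  rewrite -sumE big1 // => U US.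
  have := FN (point U); rewrite setDUl setDDl setUid.
  move: (US); rewrite -setD_eq0 => /eqP ->; rewrite setU0 eqxx negbK => /eqP ->.
  exact: mulr0.
by move/eqP; rewrite sgnsumS mulf_eq0 signr_eq0 orbF (negPf cS).
Qed.

End Multilinear.

(** * Affine forms on the cube and systems of disequalities *)

Section Clauses.
Variable n : nat.
Implicit Types (p q : linpoly n) (a b : assignment n) (C D : clause n).
Implicit Types (s : seq (linpoly n)) (A B : {set 'I_n}).

Lemma eval_linear x y p q a :
  eval (x *: p + y *: q) a = x * eval p a + y * eval q a.
Proof.
rewrite /eval /= !mulrDr addrACA !mulr_sumr -big_split /=; congr (_ + _).
by apply: eq_bigr => i _; rewrite !mxE mulrDl !mulrA.
Qed.

Lemma eval_sub_const p (v : rat) a : eval (p - (0, v : rat^o)) a = eval p a - v.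
Proof.
rewrite /eval /= addrA; congr (_ + _ - _).
by apply: eq_bigr => i _; rewrite !mxE subr0.
Qed.

Lemma eval0 a : eval (0 : linpoly n) a = 0.
Proof. by rewrite /eval big1 ?addr0 // => i _; rewrite mxE mul0r. Qed.

Definition indicator A : assignment n := [ffun i => i \in A].

Lemma indicatorK a : indicator [set i | a i] = a.
Proof. by apply/ffunP => i; rewrite ffunE inE. Qed.

Lemma degree_le_mul_eval d (F : {set 'I_n} -> rat) p :
  degree_le d F -> degree_le d.+1 (fun A => eval p (indicator A) * F A).
Proof.
move=> dF; have [c c0 cE] := degree_le_add
  (degree_le_sum (index_enum 'I_n)
     (fun i => degree_le_scale (p.1 0 i) (degree_le_mulX i dF)))
  (degree_leW (leqnSn d) (degree_le_scale p.2 dF)).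
exists c => // A; rewrite -cE /eval mulrDl mulr_suml; congr (_ + _).
by apply: eq_bigr => i _; rewrite ffunE mulrA.
Qed.

Lemma degree_le_prod_eval s :
  degree_le (size s) (fun A => \prod_(p <- s) eval p (indicator A)).
Proof.
elim: s => [|p s /(degree_le_mul_eval p) [c c0 cE]].
  by have [c c0 cE] := degree_le_const 'I_n (1 : rat); exists c => // A; rewrite big_nil.
by exists c => // A; rewrite big_cons cE.
Qed.

Definition avoids s a := all (fun p => eval p a != 0) s.

Lemma avoids_free_coordinates s a : avoids s a ->
  exists2 S : {set 'I_n}, (#|S| <= size s)%N
    & forall B, exists2 A, A :\: S = B :\: S & avoids s (indicator A).
Proof.
rewrite -{1}[a]indicatorK => sa.
have avE A : avoids s (indicator A) = (\prod_(p <- s) eval p (indicator A) != 0).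
  by rewrite prodf_seq_neq0; apply: eq_all.
rewrite avE in sa; have [S Ss SB] := degree_le_free_coordinates (degree_le_prod_eval s) sa.
by exists S => // B; have [A AB FA] := SB B; exists A; rewrite ?avE.
Qed.

(** * Signed sums of variables and the clauses of [notIm f] *)

Variable eps : 'I_n -> rat.
Hypothesis eps_sign : forall i, eps i = -1 \/ eps i = 1.
Let f : linpoly n := (\row_i eps i, 0 : rat^o).

Lemma eval_signs a : eval f a = \sum_i eps i * (a i)%:R.
Proof. by rewrite /eval addr0; apply: eq_bigr => i _; rewrite mxE. Qed.

(* Compare the points that agree outside S with the maximum and with the
   minimum of f: the n - #|S| coordinates outside S separate their values by
   more than the #|S| coordinates inside can make up for. *)
Lemma avoids_level_set s a v : avoids s a ->
  (forall b, avoids s b -> eval f b = v) -> (n <= 2 * size s)%N.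
Proof.
move=> /avoids_free_coordinates[S Ss SB] sv.
have [A AB /sv fA] := SB [set i | eps i == 1].
have [B BB /sv fB] := SB [set i | eps i == -1].
suff : (n - #|S|)%N%:R - #|S|%:R <= eval f (indicator A) - eval f (indicator B).
  have Sn : (#|S| <= n)%N by rewrite -[n in (_ <= n)%N]card_ord max_card.
  by rewrite fA fB subrr natrB // subr_le0 lerBlDr -natrD ler_nat; lia.
rewrite !eval_signs -sumrB (bigID (mem S)) /= addrC.
have -> : (n - #|S|)%N%:R = \sum_(i | i \notin S) 1 :> rat.
  rewrite sumr_const; congr (_%:R).
  by rewrite -[n in (n - _)%N]card_ord -(cardC (mem S)) addKn.
have -> : - #|S|%:R = \sum_(i in S) -1 :> rat by rewrite sumr_const mulNrn.
(* A coordinate outside [S] contributes exactly 1, one inside at least -1. *)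
apply: lerD; apply: ler_sum => i iS; rewrite !ffunE.
  move/setP/(_ i): AB; move/setP/(_ i): BB; rewrite !inE iS /= => -> ->.
  by case: (eps_sign i) => ->; rewrite ?eqxx.
by case: (eps_sign i) => ->; case: (i \in A); case: (i \in B).
Qed.

Lemma avoid_not_sat v a : ~ sat a (avoid f v) -> eval f a = v.
Proof.
move=> nsat; apply/eqP/negPn/negP => fav; apply: nsat.
exists (f - (0, eval f a : rat^o)); last by rewrite eval_sub_const subrr.
by apply/imfsetP; exists (eval f a) => //=; rewrite !inE fav andbT in_imfset.
Qed.

Lemma clause_size_gt0 C p : p \in C -> (0 < clause_size C)%N.
Proof.
move=> pC; rewrite /clause_size (big_fsetD1 p) //= /linpoly_size /rat_bits.
by rewrite /nat_bits; lia.
Qed.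

(** As [f] is 0 at the origin and 1 or -1 at a unit vector, it takes a value other than [v], so
    [avoid f v] is not empty. This makes every leaf weigh at least 1. *)
Lemma notIm_size_gt0 C : (0 < n)%N -> C \in notIm f -> (0 < clause_size C)%N.
Proof.
move=> n_gt0 /imfsetP[v /= _ ->].
have [w wv] : exists a, eval f a != v.
  have [f0|] := eqVneq (eval f (indicator set0)) v; last by exists (indicator set0).
  exists (indicator [set Ordinal n_gt0]); rewrite -f0 !eval_signs.
  rewrite [X in _ != X]big1 => [|i _]; last by rewrite ffunE inE mulr0.
  rewrite (bigD1 (Ordinal n_gt0)) //= big1 => [|i /negPf i0].
    by rewrite ffunE inE eqxx addr0 mulr1; case: (eps_sign (Ordinal n_gt0)) => ->.
  by rewrite ffunE inE i0 mulr0.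
apply: (@clause_size_gt0 _ (f - (0, eval f w : rat^o))).
by apply/imfsetP; exists (eval f w) => //=; rewrite !inE wv andbT in_imfset.
Qed.

Lemma sat_fsetU1 a p C : sat a (p |` C)%fset <-> eval p a = 0 \/ sat a C.
Proof.
split=> [[q]|[pa|[q qC qa]]].
- by rewrite !inE => /orP[/eqP-> ->|qC qa]; [left | right; exists q].
- by exists p; rewrite ?inE ?eqxx.
- by exists q; rewrite ?inE ?qC ?orbT.
Qed.

Lemma sat_fsetU a C D : sat a (C `|` D)%fset <-> sat a C \/ sat a D.
Proof.
split=> [[q]|[[q qC qa]|[q qC qa]]].
- by rewrite !inE => /orP[qC|qC] qa; [left | right]; exists q.
- by exists q; rewrite ?inE ?qC.
- by exists q; rewrite ?inE ?qC ?orbT.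
Qed.

End Clauses.

(** * Weight of the unfolding of a derivation into a tree *)

Section TreeUnfolding.
Variables (w : nat -> nat) (prem : nat -> seq nat).

(** The depth [d] is fuel for structural recursion: the tree rooted at [k] is cut off below [d]
    levels. *)
Fixpoint unfolded_weight (d k : nat) : nat :=
  if d is d'.+1 then (w k + \sum_(p <- prem k) unfolded_weight d' p)%N else 0%N.

(** More depth only adds weight. Having the same [d] on both sides allows cancellation when summing
    over lines. *)
Lemma unfolded_weight_step d k :
  (unfolded_weight d k <= w k + \sum_(p <- prem k) unfolded_weight d p)%N.
Proof.
elim: d k => [//|d IH] k /=; rewrite leq_add2l; apply: leq_sum => p _; exact: IH.
Qed.

(* Summing the step inequality over all lines, the premises, being pairwise
   distinct and smaller than N, cancel against all lines but the last. *)
Lemma unfolded_weight_le d N :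
  (forall k p, (k <= N)%N -> p \in prem k -> (p < k)%N) ->
  uniq (flatten [seq prem k | k <- iota 0 N.+1]) ->
  (unfolded_weight d N <= \sum_(0 <= k < N.+1) w k)%N.
Proof.
move=> prem_lt prem_uniq; set c := unfolded_weight d.
have : (\sum_(0 <= k < N.+1) c k <= \sum_(0 <= k < N.+1) w k + \sum_(0 <= p < N) c p)%N.
  apply: (@leq_trans (\sum_(0 <= k < N.+1) (w k + \sum_(p <- prem k) c p))).
    apply: leq_sum => k _; exact: unfolded_weight_step.
  rewrite big_split leq_add2l.
  rewrite -(big_map prem predT (fun r => \sum_(p <- r) c p)%N) -big_flatten.
  apply: (@uniq_sub_le_big _ addn leq leqnn (fun x y => leq_addr y x)) => //; first exact: iota_uniq.
  move=> p /flatten_mapP[k]; rewrite !mem_iota => kN /prem_lt; lia.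
by rewrite big_nat_recr //=; lia.
Qed.

End TreeUnfolding.

(** * The Prover-Delayer argument *)

Section LowerBound.
Variables (n : nat) (n_gt0 : (0 < n)%N) (eps : 'I_n -> rat).
Hypothesis eps_sign : forall i, eps i = -1 \/ eps i = 1.
Let f : linpoly n := (\row_i eps i, 0 : rat^o).
Variable pi : derivation n.
Hypothesis pi_ok : derivation_ok (notIm f) pi.

Let line k := nth (fset0, ByHypothesis) pi k.
Let weight k := clause_size (line k).1.
Let prem k := premises (line k).2.

Lemma earlier_nth k i : (k <= size pi)%N -> (i < k)%N ->
  nth fset0 (unzip1 (take k pi)) i = (line i).1.
Proof.
move=> kpi ik; rewrite (nth_map (fset0, ByHypothesis)) ?size_takel // nth_take //.
Qed.

Lemma size_earlier k : (k < size pi)%N -> size (unzip1 (take k pi)) = k.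
Proof. by move=> kpi; rewrite size_map size_takel // ltnW. Qed.

Lemma premise_lt k p : (k < size pi)%N -> p \in prem k -> (p < k)%N.
Proof.
move=> kpi; have := pi_ok kpi; rewrite /prem /line /inference_ok size_earlier //.
case: (nth _ pi k) => E [||i j|i] //=; rewrite !inE.
  by case=> ik jk _ /orP[]/eqP->.
by case=> ik _ /eqP->.
Qed.

(* When resolution is applied to g = 0 and h = 0, either s already forces one of
   the premises to be false, or both g <> 0 and h <> 0 can be added to s. *)
Lemma unfolded_weight_ge d k s a : (k < d)%N -> (k < size pi)%N ->
  avoids s a -> (forall b, avoids s b -> ~ sat b (line k).1) ->
  (2 ^ (uphalf n - size s) <= unfolded_weight weight prem d k)%N.
Proof.
elim: d k s a => // d IH k s a kd kpi sa s_false /=.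
have := pi_ok kpi; move: s_false.
rewrite -/(line k) -[weight k]/(clause_size (line k).1) -[prem k]/(premises (line k).2).
have le_kpi := ltnW kpi.
case: (line k) => E [||i j|i] /= s_false.
(* At a hypothesis [avoid f v], falsity forces [f = v] on all points avoiding [s]; hence the
   exponent is 0. *)
- move=> EH; move/imfsetP: (EH) => [v /= _ Ev]; rewrite big_nil addn0.
  have ns : (n <= 2 * size s)%N.
    apply: (avoids_level_set eps_sign sa (v := v)) => b sb.
    by apply: avoid_not_sat; rewrite -Ev; apply: s_false.
  have -> : (uphalf n - size s = 0)%N by lia.
  by rewrite expn0; apply: notIm_size_gt0 EH.
- by move=> E0; case: (s_false a sa); rewrite E0; exists 0; rewrite ?inE ?eval0.
- rewrite size_earlier // => -[ik jk]; rewrite !earlier_nth // => -[C [D [g [h [x [y [Ei Ej EE]]]]]]].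
  have [id jd] : (i < d)%N /\ (j < d)%N by lia.
  have [ipi jpi] : (i < size pi)%N /\ (j < size pi)%N by lia.
  have s_res b : avoids s b -> [/\ x * eval g b + y * eval h b <> 0, ~ sat b C & ~ sat b D].
    by move/s_false; rewrite EE sat_fsetU1 sat_fsetU eval_linear => nE; split=> ?; apply: nE; auto.
  rewrite big_cons big_cons big_nil addn0.
  (* If [g] vanishes wherever [s] is avoided, falsity of the resolvent forces [h] to be nonzero
     there, so the second premise is false with [s] unchanged. *)
  case: (pickP (fun b => avoids s b && (eval g b != 0))) => [b1 /andP[sb1 gb1]|g0]; last first.
    apply: (@leq_trans (unfolded_weight weight prem d j)); last by lia.
    apply: (IH _ _ a) => // b sb; rewrite Ej sat_fsetU1; have [gh _ nD] := s_res b sb.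
    case=> // hb; apply: gh; move: (g0 b); rewrite sb /= => /negbFE/eqP ->.
    by rewrite hb !mulr0 addr0.
  case: (pickP (fun b => avoids s b && (eval h b != 0))) => [b2 /andP[sb2 hb2]|h0]; last first.
    apply: (@leq_trans (unfolded_weight weight prem d i)); last by lia.
    apply: (IH _ _ a) => // b sb; rewrite Ei sat_fsetU1; have [gh nC _] := s_res b sb.
    case=> // gb; apply: gh; move: (h0 b); rewrite sb /= => /negbFE/eqP ->.
    by rewrite gb !mulr0 addr0.
  have := IH i (g :: s) b1 id ipi; rewrite /= gb1 sb1 => /(_ isT) Wi.
  have := IH j (h :: s) b2 jd jpi; rewrite /= hb2 sb2 => /(_ isT) Wj.
  (* Truncated subtraction keeps this true when the exponent on the left is 0. *)
  have : (2 ^ (uphalf n - size s) <= 2 ^ (uphalf n - (size s).+1) + 2 ^ (uphalf n - (size s).+1))%N.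
    by rewrite addnn -mul2n -expnS leq_exp2l //; lia.
  move/leq_trans; apply; apply: leq_trans (leq_addl _ _); apply: leq_add.
    apply: Wi => b /andP[/eqP gb sb]; rewrite Ei sat_fsetU1.
    by have [_ nC _] := s_res b sb; case.
  apply: Wj => b /andP[/eqP hb sb]; rewrite Ej sat_fsetU1.
  by have [_ _ nD] := s_res b sb; case.
(* A point falsifying the conclusion falsifies the premise, so [s] is kept. *)
- rewrite size_earlier // => -[ik]; rewrite earlier_nth // => iE.
  rewrite big_cons big_nil addn0; apply: leq_trans (leq_addl _ _).
  by apply: (IH _ _ a) => //; [lia | lia | move=> b sb /iE; exact: s_false].
Qed.

Lemma derivation_size_ge : tree_like pi -> (exists s, unzip1 pi = rcons s fset0) ->
  (2 ^ uphalf n <= derivation_size pi)%N.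
Proof.
move=> pi_tree [cs pi_last].
have pi_size : size pi = (size cs).+1 by rewrite -(size_map fst pi) -/unzip1 pi_last size_rcons.
have piE : pi = [seq line k | k <- iota 0 (size cs).+1].
  by rewrite -pi_size; apply/esym; exact: mkseq_nth.
have line_last : (line (size cs)).1 = fset0.
  rewrite -(nth_map _ fset0 fst) ?pi_size //.
  by rewrite -/unzip1 pi_last nth_rcons ltnn eqxx.
(* The game starts at the last line with no disequalities; the depth exceeds its position, as the
   bound on the unfolding requires. *)
apply: (@leq_trans (unfolded_weight weight prem (size cs).+1 (size cs))).
  rewrite -[uphalf n]subn0.
  apply: (@unfolded_weight_ge _ _ [::] (indicator set0)); rewrite ?pi_size //.
  by move=> b _; rewrite line_last => -[].
apply: (@leq_trans (\sum_(0 <= k < (size cs).+1) weight k)).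
  apply: unfolded_weight_le => [k p kN|]; first by apply: premise_lt; rewrite pi_size.
  by move: pi_tree; rewrite /tree_like {1}piE -map_comp.
by rewrite /derivation_size {1}piE big_map.
Qed.

End LowerBound.

Theorem mainTheorem6 (R : realType) (n : nat) (n_gt0 : (0 < n)%N)
    (eps : 'I_n -> rat) (eps_sign : forall i, eps i = -1 \/ eps i = 1)
    (pi : derivation n)
    (pi_ref : refutation (notIm (\row_i eps i, 0 : rat^o)) pi)
    (pi_tree : tree_like pi) :
  (2 : R) `^ (n%:R / 4) <= (derivation_size pi)%:R.
Proof.
case: pi_ref => pi_ok pi_last.
have := derivation_size_ge n_gt0 eps_sign pi_ok pi_tree pi_last.
rewrite -(ler_nat R) natrX -powR_mulrn // => /(le_trans _); apply.
apply: ler_powR; first by rewrite ler1n.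
have : n%:R <= 2 * (uphalf n)%:R :> R by rewrite -natrM ler_nat; lia.
have : 0 <= n%:R :> R by [].
lra.
Qed.
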